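(* Let $(N,L)$ be a pair of Lie superalgebras over $\mathbb{F}$ such that $N$ has a complement in $L$, $L/N$ is finite dimensional and $\dim(N/Z(N,L))=(m|n)$. Then $$\dim [N,L]\leq \frac{1}{2}\big((m+n)^2+(n-m)\big)+(m+n)\dim(L/N).$$
   Context: Let $\mathbb{F}$ be an algebraically closed field of characteristic $\neq 2,3$; all superspaces and superalgebras are over $\mathbb{F}$. A Lie superalgebra is a $\mathbb{Z}_2$-graded vector space $L=L_0\oplus L_1$ with a bilinear bracket such that $[L_a,L_b]\subseteq L_{a+b}$, and for homogeneous $x,y,z$ (with $|x|$ denoting the degree of $x$): $[x,y]=-(-1)^{|x||y|}[y,x]$ and $(-1)^{|x||z|}[x,[y,z]]+(-1)^{|y||x|}[y,[z,x]]+(-1)^{|z||y|}[z,[x,y]]=0$. A graded ideal of $L$ is a $\mathbb{Z}_2$-graded subspace $I$ with $[I,L]\subseteq I$. A pair of Lie superalgebras $(N,L)$ is a Lie superalgebra $L$ together with a graded ideal $N$ of $L$. A complement of $N$ in $L$ is a sub-superalgebra $K$ of $L$ with $L=N\oplus K$ as superspaces. Put $Z(N,L)=\{n\in N\mid [n,x]=0\ \text{for all } x\in L\}$ and $[N,L]=\langle [n,x]\mid n\in N,\ x\in L\rangle$ (linear span); these are graded ideals of $L$ contained in $N$. Writing $\dim V=(m|n)$ for a superspace $V=V_0\oplus V_1$ means $\dim V_0=m$ and $\dim V_1=n$ (both finite). In numerical formulas and inequalities, $\dim V$ denotes the total dimension $\dim V_0+\dim V_1$. *)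

(* Defs.v *)
From HB Require Import structures.
From mathcomp Require Import all_boot all_algebra.
From mathcomp Require Import boolp.

Set Implicit Arguments.
Unset Strict Implicit.
Unset Printing Implicit Defensive.

Import GRing.Theory.
Local Open Scope ring_scope.
Local Open Scope quotient_scope.

(* Spaces are of arbitrary dimension.  Subspaces are boolean predicates, which *)
(* is no restriction in the presence of the classical axioms of boolp.         *)
(* The group Z_2 is represented by bool, with addition addb, so that the sign  *)
(* (-1)^(|x||y|) is (-1) ^+ (a && b).                                          *)

Definition direct_sum (F : fieldType) (V : lmodType F) (A B : {pred V}) : Prop :=
  forall v, exists! p : V * V, [/\ p.1 \in A, p.2 \in B & v = p.1 + p.2].

HB.mixin Record Lmodule_isSuperspace (F : fieldType) V of GRing.Lmodule F V := {
  homog : bool -> {pred V};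
  homog_submod : forall a, submod_closed (homog a);
  homog_direct : direct_sum (homog false) (homog true)
}.

#[short(type="superspaceType")]
HB.structure Definition Superspace (F : fieldType) :=
  { V of Lmodule_isSuperspace F V & GRing.Lmodule F V }.

HB.mixin Record Superspace_isLieSuperalgebra (F : fieldType) L
    of Superspace F L := {
  bracket : L -> L -> L;
  bracket_linearl : forall y, linear (bracket^~ y);
  bracket_linearr : forall x, linear (bracket x);
  bracket_homog : forall a b x y, x \in homog a -> y \in homog b ->
    bracket x y \in homog (a (+) b);
  bracket_skew : forall a b x y, x \in homog a -> y \in homog b ->
    bracket x y = - ((-1) ^+ (a && b) *: bracket y x);
  bracket_jacobi : forall a b c x y z,
    x \in homog a -> y \in homog b -> z \in homog c ->
    (-1) ^+ (a && c) *: bracket x (bracket y z)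
    + (-1) ^+ (b && a) *: bracket y (bracket z x)
    + (-1) ^+ (c && b) *: bracket z (bracket x y) = 0
}.

#[short(type="lieSuperalgType")]
HB.structure Definition LieSuperalgebra (F : fieldType) :=
  { L of Superspace_isLieSuperalgebra F L & Superspace F L }.

Definition graded (F : fieldType) (V : superspaceType F) (S : {pred V}) : Prop :=
  forall v, v \in S -> exists v0 v1 : V,
    [/\ v0 \in S, v0 \in homog false, v1 \in S, v1 \in homog true
      & v = v0 + v1].

Record gradedSubspace (F : fieldType) (V : superspaceType F) := GradedSubspace {
  gset :> {pred V};
  gset_submod : submod_closed gset;
  gset_graded : graded gset
}.

HB.instance Definition _ (F : fieldType) (V : superspaceType F)
    (S : gradedSubspace V) :=
  GRing.isSubmodClosed.Build F V (gset S) (gset_submod S).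

Record subSuperalgebra (F : fieldType) (L : lieSuperalgType F) := SubSuperalgebra {
  subalg_gset :> gradedSubspace L;
  subalg_bracket : {in subalg_gset &, forall x y, bracket x y \in subalg_gset}
}.

Record gradedIdeal (F : fieldType) (L : lieSuperalgType F) := GradedIdeal {
  ideal_gset :> gradedSubspace L;
  ideal_bracket : {in ideal_gset, forall x y, bracket x y \in ideal_gset}
}.

Definition has_complement (F : fieldType) (L : lieSuperalgType F)
    (N : gradedIdeal L) : Prop :=
  exists K : subSuperalgebra L, direct_sum N K.

Section SuperspaceTheory.
Variables (F : fieldType) (V : superspaceType F).

Lemma homog0 a : (0 : V) \in homog a.
Proof. exact: (homog_submod a).1. Qed.

Lemma homogZD a (c : F) (u v : V) :
  u \in homog a -> v \in homog a -> c *: u + v \in homog a.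
Proof. by move=> hu hv; apply: (homog_submod a).2. Qed.

Lemma homogD a (u v : V) : u \in homog a -> v \in homog a -> u + v \in homog a.
Proof. by move=> hu hv; rewrite -[u]scale1r; apply: homogZD. Qed.

Lemma homogN a (u : V) : u \in homog a -> - u \in homog a.
Proof.
by move=> hu; rewrite -scaleN1r -[_ *: _]addr0; apply: homogZD (homog0 a).
Qed.

Lemma homog_split (v : V) : exists v0 v1 : V,
  [/\ v0 \in homog false, v1 \in homog true & v = v0 + v1].
Proof. by have [[v0 v1] [[/= h0 h1 e] _]] := homog_direct v; exists v0, v1. Qed.

Lemma homog_eq0 a (u v : V) :
  u \in homog a -> v \in homog (~~ a) -> u + v = 0 -> u = 0 /\ v = 0.
Proof.
wlog -> : a u v / a = false => [IH|] hu hv e.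
  case: a hu hv => hu hv; last exact: (IH false).
  by have [||||-> ->] := IH false v u; rewrite // addrC.
have [p [_ U]] := homog_direct (0 : V).
have U0 := U (0, 0) (And3 (homog0 _) (homog0 _) (esym (addr0 0))).
by have := U (u, v) (And3 hu hv (esym e)); rewrite U0 => -[-> ->].
Qed.

Lemma fullspace_submod : submod_closed (predT : V -> bool). Proof. by []. Qed.

Lemma fullspace_graded : graded (predT : V -> bool).
Proof. by move=> v _; have [v0 [v1 [h0 h1 ->]]] := homog_split v; exists v0, v1. Qed.

Definition fullspace : gradedSubspace V :=
  GradedSubspace fullspace_submod fullspace_graded.

Definition has_dim (S : {pred V}) (d : nat) : Prop :=
  exists e : 'I_d -> V,
    (forall c : 'I_d -> F, \sum_i c i *: e i = 0 -> forall i, c i = 0) /\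
    (forall v, v \in S <-> exists c : 'I_d -> F, v = \sum_i c i *: e i).

Definition has_sdim (S : gradedSubspace V) (m n : nat) : Prop :=
  has_dim [predI S & homog false] m /\ has_dim [predI S & homog true] n.

Definition lspan (G : V -> Prop) : V -> bool := fun v =>
  `[< exists (k : nat) (c : 'I_k -> F) (g : 'I_k -> V),
        (forall i, G (g i)) /\ v = \sum_i c i *: g i >].

Lemma lspan_submod (G : V -> Prop) : submod_closed (lspan G).
Proof.
split=> [|a u v /asboolP[k [c [g [Gg ->]]]] /asboolP[l [d [h [Gh ->]]]]].
  apply/asboolP; exists 0, (fun _ => 0), (fun _ => 0).
  by split=> [[]|] //; rewrite big_ord0.
apply/asboolP; exists (k + l)%N.
exists (fun i => match split i with inl i => a * c i | inr j => d j end).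
exists (fun i => match split i with inl i => g i | inr j => h j end).
split=> [i|]; first by case: (split i).
rewrite big_split_ord scaler_sumr /=; congr (_ + _); apply: eq_bigr => i _.
  by have := unsplitK (inl i : 'I_k + 'I_l) => /= ->; rewrite scalerA.
by have := unsplitK (inr i : 'I_k + 'I_l) => /= ->.
Qed.

End SuperspaceTheory.

(* The quotient superspace V / W, on top of the quotient Z-module of          *)
(* ring_quotient; (V / W)_a is the image of V_a.                              *)
Section QuotientSuperspace.
Variables (F : fieldType) (V : superspaceType F) (W : gradedSubspace V).

Definition squot := Quotient.quot W.
HB.instance Definition _ := GRing.Zmodule.on squot.

Definition sproj (v : V) : squot := \pi_(Quotient.quot W) v.

Lemma sprojP (q : squot) : exists v, q = sproj v.
Proof. by exists (repr q); rewrite /sproj reprK. Qed.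

Lemma sproj_eq u v : (sproj u = sproj v) <-> (u - v \in W).
Proof.
by rewrite (Quotient.idealrBE W); split=> [e|/eqP//]; apply/eqP.
Qed.

Lemma sprojD u v : sproj (u + v) = sproj u + sproj v.
Proof. exact: (raddfD (\pi_(Quotient.quot W))). Qed.

Definition squot_scale (c : F) (q : squot) : squot := sproj (c *: repr q).

Lemma sprojZ c v : sproj (c *: v) = squot_scale c (sproj v).
Proof.
apply/sproj_eq; rewrite -scalerBr; apply: rpredZ.
by apply/sproj_eq; rewrite /sproj reprK.
Qed.

Lemma squot_scaleA a b q :
  squot_scale a (squot_scale b q) = squot_scale (a * b) q.
Proof. by have [v ->] := sprojP q; rewrite -!sprojZ scalerA. Qed.

Lemma squot_scale1 : left_id 1 squot_scale.
Proof. by move=> q; have [v ->] := sprojP q; rewrite -sprojZ scale1r. Qed.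

Lemma squot_scaleDr : right_distributive squot_scale +%R.
Proof.
move=> c p q; have [u ->] := sprojP p; have [v ->] := sprojP q.
by rewrite -sprojD -!sprojZ -sprojD scalerDr.
Qed.

Lemma squot_scaleDl q : {morph squot_scale^~ q : a b / a + b}.
Proof.
by move=> a b; have [v ->] := sprojP q; rewrite -!sprojZ -sprojD scalerDl.
Qed.

HB.instance Definition _ := GRing.Zmodule_isLmodule.Build F squot
  squot_scaleA squot_scale1 squot_scaleDr squot_scaleDl.

Definition simage (S : {pred V}) : squot -> bool := fun q =>
  `[< exists2 v, v \in S & q = sproj v >].

Lemma simage_submod (S : {pred V}) : submod_closed S -> submod_closed (simage S).
Proof.
move=> [S0 SZ]; split=> [|a _ _ /asboolP[u Su ->] /asboolP[v Sv ->]].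
  apply/asboolP; exists 0 => //.
  by rewrite /sproj (raddf0 (\pi_(Quotient.quot W))).
by apply/asboolP; exists (a *: u + v); rewrite ?SZ // sprojD sprojZ.
Qed.

Lemma simage_direct :
  direct_sum (simage (homog false)) (simage (homog true)).
Proof.
move=> q; have [v ->] := sprojP q; have [v0 [v1 [h0 h1 ->]]] := homog_split v.
exists (sproj v0, sproj v1); split=> /=.
  by split; rewrite ?sprojD //; apply/asboolP; [exists v0 | exists v1].
move=> [_ _] /= [/asboolP[u0 k0 ->] /asboolP[u1 k1 ->]].
rewrite -sprojD => /sproj_eq.
move=> /gset_graded[w0 [w1 [W0 j0 W1 j1]]] e.
have /eqP e0 : (v0 - u0 - w0) + (v1 - u1 - w1) = 0.
  by rewrite addrACA -opprD addrACA -opprD e subrr.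
have [||/eqP + /eqP] := @homog_eq0 _ _ false _ _ _ _ (eqP e0);
  do ?by rewrite ?homogD ?homogN.
rewrite !subr_eq0 => /eqP e1 /eqP e2.
by congr (_, _); apply/sproj_eq; rewrite ?e1 ?e2.
Qed.

HB.instance Definition _ := Lmodule_isSuperspace.Build F squot
  (fun a => simage_submod (homog_submod a)) simage_direct.

End QuotientSuperspace.

Arguments sproj {F V} W v.
Arguments simage {F V} W S q.
Arguments simage_submod {F V} W S.

(* For W contained in S, the quotient S / W as a graded subspace of V / W.    *)
Section QuotientOfSubspace.
Variables (F : fieldType) (V : superspaceType F) (S W : gradedSubspace V).

Lemma subquot_submod : submod_closed (simage W S).
Proof. exact: simage_submod (gset_submod S). Qed.

Lemma subquot_graded : graded (simage W S).
Proof.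
move=> q /asboolP[v /gset_graded[v0 [v1 [S0 h0 S1 h1 ->]]] ->].
exists (sproj W v0), (sproj W v1).
by split; rewrite ?sprojD //; apply/asboolP; [exists v0|exists v0|exists v1|exists v1].
Qed.

Definition subquot : gradedSubspace (squot W) :=
  GradedSubspace subquot_submod subquot_graded.

End QuotientOfSubspace.

Section Pair.
Variables (F : fieldType) (L : lieSuperalgType F) (N : gradedIdeal L).

Definition pair_center_pred : L -> bool := fun n =>
  (n \in N) && `[< forall x, bracket n x = 0 >].

Lemma bracket0l (x : L) : bracket 0 x = 0.
Proof.
by have := bracket_linearl x (-1) 0 0; rewrite scaleN1r oppr0 addr0 scaleN1r addNr.
Qed.

Lemma bracketDl (x y z : L) : bracket (x + y) z = bracket x z + bracket y z.
Proof. by have := bracket_linearl z 1 x y; rewrite !scale1r. Qed.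

Lemma bracketDr (x y z : L) : bracket x (y + z) = bracket x y + bracket x z.
Proof. by have := bracket_linearr x 1 y z; rewrite !scale1r. Qed.

Lemma pair_center_submod : submod_closed pair_center_pred.
Proof.
split=> [|a u v /andP[Nu /asboolP zu] /andP[Nv /asboolP zv]].
  by apply/andP; split; [exact: rpred0 | apply/asboolP; exact: bracket0l].
apply/andP; split; first by rewrite rpredD ?rpredZ.
by apply/asboolP => x; rewrite bracket_linearl zu zv scaler0 addr0.
Qed.

Lemma pair_center_graded : graded pair_center_pred.
Proof.
move=> v /andP[/gset_graded[v0 [v1 [N0 h0 N1 h1 ->]]] /asboolP z].
have zh a x : x \in homog a -> bracket v0 x = 0 /\ bracket v1 x = 0.
  move=> hx; apply: (@homog_eq0 _ _ a); last by rewrite -bracketDl.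
    by have := bracket_homog _ _ _ _ h0 hx.
  by have := bracket_homog _ _ _ _ h1 hx.
have zz x : bracket v0 x = 0 /\ bracket v1 x = 0.
  have [x0 [x1 [k0 k1 ->]]] := homog_split x.
  have [a0 b0] := zh _ _ k0; have [a1 b1] := zh _ _ k1.
  by rewrite !bracketDr a0 a1 b0 b1 addr0.
exists v0, v1; split=> //; apply/andP; split=> //; apply/asboolP => x;
  by case: (zz x).
Qed.

Definition pair_center : gradedSubspace L :=
  GradedSubspace pair_center_submod pair_center_graded.

Definition pair_bracket_pred : L -> bool :=
  lspan (fun v : L => exists2 n, n \in N & exists x, v = bracket n x).

Lemma pair_bracket_submod : submod_closed pair_bracket_pred.
Proof. exact: lspan_submod. Qed.
HB.instance Definition _ := GRing.isSubmodClosed.Build F L pair_bracket_pred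
  pair_bracket_submod.

Lemma pair_bracket_graded : graded pair_bracket_pred.
Proof.
have PB n x : n \in N -> bracket n x \in pair_bracket_pred.
  move=> Nn; apply/asboolP; exists 1%N, (fun _ => 1), (fun _ => bracket n x).
  by split=> [i|]; [exists n => //; exists x | rewrite big_ord1 scale1r].
move=> v /asboolP[k [c [g [Gg ->]]]].
elim/big_ind: _ => [|u w [u0 [u1 [? ? ? ? ->]]] [w0 [w1 [? ? ? ? ->]]]|i _].
- by exists 0, 0; split; rewrite ?addr0 ?homog0 ?rpred0.
- exists (u0 + w0), (u1 + w1).
  by split; rewrite ?homogD ?rpredD // addrACA.
have [n /gset_graded[n0 [n1 [N0 h0 N1 h1 ->]]] [x ->]] := Gg i.
have [x0 [x1 [k0 k1 ->]]] := homog_split x.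
exists (c i *: (bracket n0 x0 + bracket n1 x1)).
exists (c i *: (bracket n0 x1 + bracket n1 x0)).
split.
- by rewrite rpredZ // rpredD ?PB.
- rewrite -[_ *: _]addr0; apply: homogZD (homog0 _ _); apply: homogD.
    by have := bracket_homog _ _ _ _ h0 k0.
  by have := bracket_homog _ _ _ _ h1 k1.
- by rewrite rpredZ // rpredD ?PB.
- rewrite -[_ *: _]addr0; apply: homogZD (homog0 _ _); apply: homogD.
    by have := bracket_homog _ _ _ _ h0 k1.
  by have := bracket_homog _ _ _ _ h1 k0.
by rewrite -scalerDr bracketDl !bracketDr [_ n1 x0 + _]addrC addrACA.
Qed.

Definition pair_bracket : gradedSubspace L :=
  GradedSubspace pair_bracket_submod pair_bracket_graded.

End Pair.

(* Main.v *)
From HB Require Import structures.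
Require Import Defs.
From mathcomp Require Import all_boot all_order all_algebra.
From mathcomp Require Import boolp.
From mathcomp Require Import zify lra.

Set Implicit Arguments.
Unset Strict Implicit.
Unset Printing Implicit Defensive.

Import GRing.Theory Num.Theory.
Local Open Scope ring_scope.

(** The bound counts homogeneous generators of [N, L].  Put M = m + n and lift
    a homogeneous basis of N / Z(N, L) to elements e_i of N, i < M, and one of
    L / N to elements f_k of L, k < p + q.  Every element of N is a combination
    of the e_i plus an element of Z(N, L), and every element of L is a
    combination of the f_k and the e_i plus an element of Z(N, L).  An element
    of Z(N, L) brackets to zero with everything, on either side by
    skew-supersymmetry ([bracket_pair_center]), so [N, L] is spanned by the
    [e_i, e_j] and the [e_i, f_k].  Skew-supersymmetry leaves among the former
    only those with i < j and, since 2 is invertible, those with i = j and e_i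
    odd ([bracket_even_self]).  The number of remaining generators is
    M (M - 1) / 2 + n + M (p + q), which is the asserted bound.

    All these generators are homogeneous, so the even and the odd part of
    [N, L] are spanned by the generators of the corresponding parity, and the
    total dimension is at most the number of generators ([has_sdim_span]). *)

(** * Bases extracted from finite spanning families *)

Lemma has_dim_span_ord (F : fieldType) (V : superspaceType F) (S : {pred V})
    (k : nat) (g : 'I_k -> V) :
  submod_closed S -> (forall i, g i \in S) ->
  (forall v, v \in S -> exists c : 'I_k -> F, v = \sum_i c i *: g i) ->
  exists2 d, (d <= k)%N & has_dim S d.
Proof.
move=> [S0 SZ]; elim: k g => [|k IH] g gS gen.
  exists 0%N => //; exists g; split=> [c _ []//|v]; split=> [/gen//|[c ->]].
  by rewrite big_ord0.
have [fr|] := pselect (forall c : 'I_k.+1 -> F,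
  \sum_i c i *: g i = 0 -> forall i, c i = 0).
  exists k.+1 => //; exists g; split=> // v; split=> [/gen//|[c ->]].
  apply: (big_ind (fun v => v \in S)) => // [u w Su Sw|i _].
    by rewrite -[u]scale1r SZ.
  by rewrite -[_ *: _]addr0 SZ.
(* In a linear relation with c i <> 0, the generator g i is redundant. *)
move=> /existsNP[c /not_implyP[c0 /existsNP[i /eqP ci]]].
have [d dk hd] : exists2 d, (d <= k)%N & has_dim S d; last first.
  by exists d => //; exact: leqW.
apply: (IH (fun j => g (lift i j))) => // v /gen[b ->].
have gi : g i = \sum_(j < k) - ((c i)^-1 * c (lift i j)) *: g (lift i j).
  apply: (scalerI ci); move: c0; rewrite (bigD1_ord i) //= => /eqP.
  rewrite addr_eq0 => /eqP ->; rewrite scaler_sumr -sumrN.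
  by apply: eq_bigr => j _; rewrite scalerA mulrN mulrA mulfV // mul1r scaleNr.
exists (fun j => b i * - ((c i)^-1 * c (lift i j)) + b (lift i j)).
rewrite (bigD1_ord i) //= gi scaler_sumr -big_split /=; apply: eq_bigr => j _.
by rewrite scalerA -scalerDl.
Qed.

Lemma has_dim_span (F : fieldType) (V : superspaceType F) (S : {pred V})
    (I : finType) (A : {pred I}) (g : I -> V) :
  submod_closed S -> (forall i, i \in A -> g i \in S) ->
  (forall v, v \in S -> exists c : I -> F, v = \sum_(i in A) c i *: g i) ->
  exists2 d, (d <= #|A|)%N & has_dim S d.
Proof.
move=> Ssub gS gen.
apply: (has_dim_span_ord (g := fun i : 'I_#|A| => g (enum_val i))) => //.
  by move=> i; apply: gS; exact: enum_valP.
move=> v /gen[c ->]; exists (fun i => c (enum_val i)).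
by rewrite (big_enum_val (fun i => c i *: g i)).
Qed.

Lemma homog_sum (F : fieldType) (V : superspaceType F) (I : finType)
    (A : {pred I}) (a : bool) (c : I -> F) (g : I -> V) :
  (forall i, i \in A -> g i \in homog a) -> \sum_(i in A) c i *: g i \in homog a.
Proof.
move=> gh; apply: (big_ind (fun v => v \in homog a)) => [|u v|i iA].
- exact: homog0.
- exact: homogD.
- by rewrite -[_ *: _]addr0; apply: homogZD (homog0 _ _); apply: gh.
Qed.

(** A graded subspace spanned by finitely many homogeneous elements has total
    dimension at most their number. *)
Lemma has_sdim_span (F : fieldType) (V : superspaceType F)
    (W : gradedSubspace V) (I : finType) (par : I -> bool) (g : I -> V) :
  (forall i, g i \in homog (par i)) -> (forall i, g i \in W) ->
  (forall v, v \in W -> exists c : I -> F, v = \sum_i c i *: g i) ->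
  exists r s : nat, has_sdim W r s /\ (r + s <= #|I|)%N.
Proof.
move=> gh gW gen.
have part a : exists2 d, (d <= #|[pred i | par i == a]|)%N &
    has_dim [predI W & homog a] d.
  apply: (has_dim_span (g := g)).
  - split=> [|b u v]; rewrite !inE; first by rewrite rpred0 homog0.
    by case/andP=> uW uh /andP[vW vh]; rewrite rpredD ?rpredZ ?homogZD.
  - by move=> i /eqP <-; rewrite inE /= gW gh.
  move=> v /andP[/gen[c ve] vh]; exists c.
  (* The part of the sum of the other parity vanishes. *)
  have [] := @homog_eq0 _ _ a (\sum_(i in [pred i | par i == a]) c i *: g i - v)
     (\sum_(i in [predC [pred i | par i == a]]) c i *: g i).
  - by apply: homogD (homogN vh); apply: homog_sum => i /eqP <-.
  - apply: homog_sum => i; rewrite !inE => /eqP pa.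
    suff <- : par i = ~~ a by [].
    by case: (par i) (a) pa => [] [].
  - rewrite addrAC; apply/eqP; rewrite subr_eq0; apply/eqP.
    by rewrite ve [RHS](bigID (mem [pred i | par i == a])).
  by move=> /eqP; rewrite subr_eq0 => /eqP.
have [r lr hr] := part false; have [s ls hs] := part true.
exists r, s; split=> //.
rewrite -(cardC [pred i | par i == false]) leq_add //.
by apply: (leq_trans ls); apply: subset_leq_card; apply/fintype.subsetP => i;
  rewrite !inE => /eqP ->.
Qed.

(** * Homogeneous lifts of a basis of a quotient *)

(** A homogeneous basis of a graded subspace T of V / W lifts to homogeneous
    elements of V; the first m of them are even and the last n are odd. *)
Lemma has_sdim_lift (F : fieldType) (V : superspaceType F)
    (W : gradedSubspace V) (T : gradedSubspace (squot W)) (m n : nat) :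
  has_sdim T m n ->
  exists e : 'I_(m + n) -> V,
    [/\ forall i, e i \in homog (m <= i)%N,
        forall i, sproj W (e i) \in T &
        forall v, sproj W v \in T ->
          exists c : 'I_(m + n) -> F, v - \sum_i c i *: e i \in W].
Proof.
have lift a d : has_dim [predI T & homog a] d -> exists e : 'I_d -> V,
    [/\ forall i, e i \in homog a, forall i, sproj W (e i) \in T &
      forall q, q \in T -> q \in homog a -> exists c : 'I_d -> F,
        q = sproj W (\sum_i c i *: e i)].
  move=> [b [_ bS]].
  have bT i : b i \in [predI T & homog a].
    apply/bS; exists (fun j => (i == j)%:R).
    rewrite (bigD1 i) //= eqxx scale1r big1 ?addr0 // => j.
    by rewrite eq_sym => /negPf ->; rewrite scale0r.
  have /choice[e eP] : forall i, exists v, v \in homog a /\ b i = sproj W v.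
    by move=> i; have /andP[_ /asboolP[v vh ->]] := bT i; exists v.
  exists e; split=> [i|i|q qT qh].
  - by have [] := eP i.
  - by have [_ <-] := eP i; have /andP[] := bT i.
  have /bS[c ->] : q \in [predI T & homog a] by apply/andP.
  exists c; elim/big_rec2: _ => [|i u v _ ->].
    by rewrite /sproj (raddf0 (\pi_(Quotient.quot W)%qT)).
  by rewrite sprojD sprojZ; congr (_ + _); have [_ ->] := eP i.
move=> [/lift[e0 [h0 T0 g0]] /lift[e1 [h1 T1 g1]]].
exists (fun i => match split i with inl j => e0 j | inr j => e1 j end).
split=> [i|i|v vT].
- by case: splitP => j ->; rewrite ?leq_addr // leqNgt ltn_ord.
- by case: (split i).
have [q0 [q1 [q0T q0h q1T q1h ve]]] := gset_graded vT.
have [c0 q0e] := g0 _ q0T q0h; have [c1 q1e] := g1 _ q1T q1h.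
exists (fun i => match split i with inl j => c0 j | inr j => c1 j end).
apply/sproj_eq; rewrite ve q0e q1e -sprojD big_split_ord /=; congr (sproj _ (_ + _)).
  apply: eq_bigr => i _.
  by have := unsplitK (inl i : 'I_m + 'I_n) => /= ->.
apply: eq_bigr => i _.
by have := unsplitK (inr i : 'I_m + 'I_n) => /= ->.
Qed.

(** * Brackets *)

Section Brackets.
Variables (F : fieldType) (L : lieSuperalgType F).

Lemma bracket0r (x : L) : bracket x 0 = 0.
Proof. by apply: (addIr (bracket x 0)); rewrite -bracketDr !add0r. Qed.

Lemma bracketZl c (x y : L) : bracket (c *: x) y = c *: bracket x y.
Proof. by have := bracket_linearl y c x 0; rewrite bracket0l !addr0. Qed.

Lemma bracketZr c (x y : L) : bracket x (c *: y) = c *: bracket x y.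
Proof. by have := bracket_linearr x c y 0; rewrite bracket0r !addr0. Qed.

Lemma bracket_suml (I : finType) (c : I -> F) (e : I -> L) y :
  bracket (\sum_i c i *: e i) y = \sum_i c i *: bracket (e i) y.
Proof.
elim/big_rec2: _ => [|i u v _ <-]; first exact: bracket0l.
by rewrite bracketDl bracketZl.
Qed.

Lemma bracket_sumr (I : finType) (c : I -> F) (e : I -> L) x :
  bracket x (\sum_i c i *: e i) = \sum_i c i *: bracket x (e i).
Proof.
elim/big_rec2: _ => [|i u v _ <-]; first exact: bracket0r.
by rewrite bracketDr bracketZr.
Qed.

Lemma bracket_even_self (x : L) :
  2%N \notin [pchar F] -> x \in homog false -> bracket x x = 0.
Proof.
rewrite inE /= => two xh; have := bracket_skew _ _ _ _ xh xh.
rewrite expr0 scale1r => /eqP; rewrite -addr_eq0 -mulr2n -scaler_nat.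
by rewrite scaler_eq0 (negPf two) => /eqP.
Qed.

(** Z(N, L) is defined by brackets from the left; its homogeneous components,
    which lie in it too, also vanish in brackets from the right. *)
Lemma bracket_pair_center (N : gradedIdeal L) (x z : L) :
  z \in pair_center N -> bracket x z = 0.
Proof.
move=> /gset_graded[z0 [z1 [/andP[_ /asboolP Z0] h0 /andP[_ /asboolP Z1] h1 ->]]].
have [x0 [x1 [k0 k1 ->]]] := homog_split x.
have skew a b (u v : L) : u \in homog a -> v \in homog b -> bracket v u = 0 ->
    bracket u v = 0.
  by move=> uh vh vu; rewrite (bracket_skew _ _ _ _ uh vh) vu scaler0 oppr0.
rewrite bracketDl !bracketDr (skew _ _ _ _ k0 h0 (Z0 _)) (skew _ _ _ _ k0 h1 (Z1 _)).
by rewrite (skew _ _ _ _ k1 h0 (Z0 _)) (skew _ _ _ _ k1 h1 (Z1 _)) !addr0.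
Qed.

Lemma bracket_in_pair_bracket (N : gradedIdeal L) (x y : L) :
  x \in N -> bracket x y \in pair_bracket N.
Proof.
move=> xN; apply/asboolP; exists 1%N, (fun _ => 1), (fun _ => bracket x y).
by split=> [_|]; [exists x => //; exists y | rewrite big_ord1 scale1r].
Qed.

Lemma pair_bracket_min (N : gradedIdeal L) (S : L -> bool) :
  submod_closed S -> (forall x y, x \in N -> S (bracket x y)) ->
  forall v, v \in pair_bracket N -> S v.
Proof.
move=> [S0 SZ] SB v /asboolP[k [c [g [gP ->]]]].
apply: (big_ind S) => // [u w Su Sw|i _].
  by rewrite -[u]scale1r; apply: SZ.
rewrite -[_ *: _]addr0; apply: SZ => //.
by have [x xN [y ->]] := gP i; apply: SB.
Qed.

End Brackets.

(** * Generators of [N, L] *)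

(** The linear span of a finite family. *)
Definition famspan (F : fieldType) (V : lmodType F) (I : finType) (g : I -> V) :
  V -> bool := fun v => `[< exists c : I -> F, v = \sum_i c i *: g i >].

Lemma famspan_submod (F : fieldType) (V : lmodType F) (I : finType)
  (g : I -> V) : submod_closed (famspan g).
Proof.
split=> [|a _ _ /asboolP[c ->] /asboolP[d ->]]; apply/asboolP.
  by exists (fun _ => 0); rewrite big1 // => i _; rewrite scale0r.
exists (fun i => a * c i + d i); rewrite scaler_sumr -big_split /=.
by apply: eq_bigr => i _; rewrite scalerA -scalerDl.
Qed.

HB.instance Definition _ (F : fieldType) (V : lmodType F) (I : finType)
  (g : I -> V) := GRing.isSubmodClosed.Build F V (famspan g) (famspan_submod g).

Lemma mem_famspan (F : fieldType) (V : lmodType F) (I : finType)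
  (g : I -> V) (i : I) : g i \in famspan g.
Proof.
apply/asboolP; exists (fun j => (i == j)%:R).
rewrite (bigD1 i) //= eqxx scale1r big1 ?addr0 // => j.
by rewrite eq_sym => /negPf ->; rewrite scale0r.
Qed.

Section Generators.
Variables (F : fieldType) (L : lieSuperalgType F) (m n t : nat).
Variables (e : 'I_(m + n) -> L) (f : 'I_t -> L).

(** Indices of the generators: the pairs i < j for [e_i, e_j], an odd e_i for
    [e_i, e_i], and the pairs (i, k) for [e_i, f_k]. *)
Definition genIndex : finType :=
  ({j : 'I_(m + n) & 'I_j} + 'I_n + 'I_(m + n) * 'I_t)%type.

(** An index i < j seen among all m + n indices. *)
Definition below (j : 'I_(m + n)) (i : 'I_j) : 'I_(m + n) :=
  widen_ord (ltnW (ltn_ord j)) i.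

Definition generator (x : genIndex) : L :=
  match x with
  | inl (inl u) => bracket (e (below (tagged u))) (e (tag u))
  | inl (inr i) => bracket (e (rshift m i)) (e (rshift m i))
  | inr u => bracket (e u.1) (f u.2)
  end.

(** The parity of a generator when f_k has parity [pf k]; e_i is odd exactly
    when m <= i. *)
Definition generator_parity (pf : 'I_t -> bool) (x : genIndex) : bool :=
  match x with
  | inl (inl u) => (m <= below (tagged u))%N (+) (m <= tag u)%N
  | inl (inr i) => false
  | inr u => (m <= u.1)%N (+) pf u.2
  end.

Lemma card_genIndex : #|genIndex| = ('C(m + n, 2) + n + (m + n) * t)%N.
Proof.
rewrite !card_sum card_prod !card_ord card_tagged sumnE big_map.
rewrite big_enum /=; congr (_ + _ + _)%N.
by rewrite -bin2_sum big_mkord; apply: eq_bigr => j _; rewrite card_ord.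
Qed.

Hypothesis eh : forall i, e i \in homog (m <= i)%N.

Lemma generator_homog (pf : 'I_t -> bool) (x : genIndex) :
  (forall k, f k \in homog (pf k)) -> generator x \in homog (generator_parity pf x).
Proof.
move=> fh; case: x => [[u|i]|u]; try exact: bracket_homog.
by have := bracket_homog _ _ _ _ (eh (rshift m i)) (eh (rshift m i));
  rewrite addbb.
Qed.

Lemma bracket_in_famspan (i j : 'I_(m + n)) :
  2%N \notin [pchar F] -> bracket (e i) (e j) \in famspan generator.
Proof.
move=> two.
have lt_case (i' j' : 'I_(m + n)) : (i' < j')%N ->
    bracket (e i') (e j') \in famspan generator.
  move=> lt_ij; have := mem_famspan generator
    (inl (inl (Tagged (fun j : 'I_(m + n) => 'I_j) (Ordinal lt_ij)))).
  by rewrite /=; have -> : below (Ordinal lt_ij) = i' by apply: val_inj.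
have [lt_ij|lt_ji|/val_inj ->] := ltngtP i j; first exact: lt_case.
  rewrite (bracket_skew _ _ _ _ (eh i) (eh j)) rpredN rpredZ //.
  exact: lt_case.
have [mj|jm] := leqP m j; last first.
  rewrite bracket_even_self ?rpred0 //.
  by have := eh j; rewrite leqNgt jm.
have jn : (j - m < n)%N by rewrite ltn_subLR.
have := mem_famspan generator (inl (inr (Ordinal jn))).
rewrite /=; have -> // : rshift m (Ordinal jn) = j.
by apply: val_inj; rewrite /= subnKC.
Qed.

End Generators.

Theorem theorem3p1 (F : closedFieldType)
  (char2 : 2%N \notin [pchar F]) (char3 : 3%N \notin [pchar F])
  (L : lieSuperalgType F) (N : gradedIdeal L) (m n p q : nat)
  (hK : has_complement N)
  (hLN : has_sdim (fullspace (squot N)) p q)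
  (hNZ : has_sdim (subquot N (pair_center N)) m n) :
  exists r s : nat, has_sdim (pair_bracket N) r s /\
    ((r + s)%:R : rat) <=
      2^-1 * ((m + n)%:R ^+ 2 + (n%:R - m%:R)) + (m + n)%:R * (p + q)%:R.
Proof.
have [f [fh _ fgen]] := has_sdim_lift hLN.
have [e [eh eT egen]] := has_sdim_lift hNZ.
have eN i : e i \in N.
  have /asboolP[v vN /sproj_eq/andP[evN _]] := eT i.
  by rewrite -[e i](subrK v) rpredD.
have Ndec x : x \in N ->
    exists c, exists2 z, z \in pair_center N & x = z + \sum_i c i *: e i.
  move=> xN; have [|c cP] := egen x; first by apply/asboolP; exists x.
  by exists c, (x - \sum_i c i *: e i) => //; rewrite subrK.
pose g := generator e f.
have gN x : g x \in pair_bracket N.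
  by case: x => [[u|i]|u]; exact: bracket_in_pair_bracket.
have gspan v : v \in pair_bracket N -> exists c, v = \sum_i c i *: g i.
  move=> vN; apply/asboolP; move: v vN.
  apply: pair_bracket_min (famspan_submod g) _ => x y /Ndec[c [z zZ ->]].
  have [d /Ndec[b [w wZ yE]]] := fgen y isT.
  have {yE}-> : y = w + \sum_i b i *: e i + \sum_k d k *: f k.
    by rewrite -yE subrK.
  have /andP[_ /asboolP z0] := zZ.
  rewrite bracketDl z0 add0r bracket_suml; apply: rpred_sum => i _.
  apply: rpredZ; rewrite !bracketDr (bracket_pair_center _ wZ) add0r.
  rewrite !bracket_sumr; apply: rpredD; apply: rpred_sum => j _; apply: rpredZ.
    exact: bracket_in_famspan.
  exact: (mem_famspan g (inr (i, j))).
have [r [s [rs_dim rs_le]]] :=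
  has_sdim_span (fun x => generator_homog eh x fh) gN gspan.
exists r, s; split=> //.
move: rs_le; rewrite card_genIndex.
have : ('C(m + n, 2) * 2 + (m + n) = (m + n) * (m + n))%N.
  by elim: (m + n)%N => [//|M IH]; rewrite binS bin1; nia.
move=> /(congr1 (fun k => k%:R : rat)) + rs_le.
have : ((r + s)%:R : rat) <= ('C(m + n, 2) + n + (m + n) * (p + q))%:R.
  by rewrite ler_nat.
rewrite !natrD !natrM !natrD; nra.
Qed.
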